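(* Let $\mathcal{A}$ and $\mathcal{B}$ be nice GFG-tNCWs with $L(\mathcal{A})=L(\mathcal{B})$, each of which is minimal (no GFG-tNCW for this language has fewer states). Then $\mathcal{A}$ and $\mathcal{B}$ are safe isomorphic.
   Context: A tNCW is $\mathcal{A}=\langle \Sigma,Q,q_0,\delta,\alpha\rangle$ with finite alphabet $\Sigma$, finite state set $Q$, initial state $q_0$, total transition function $\delta:Q\times\Sigma\to 2^Q\setminus\{\emptyset\}$ with transition relation $\Delta=\{\langle q,\sigma,s\rangle: s\in\delta(q,\sigma)\}$, and $\alpha\subseteq\Delta$ ($\alpha$-transitions; the rest are $\bar\alpha$-transitions); $\delta^{\bar\alpha}(q,\sigma)$ is the set of $s$ with $\langle q,\sigma,s\rangle\in\Delta\setminus\alpha$. A run on $w=\sigma_1\sigma_2\cdots$ is $r_0r_1\cdots$ with $r_0=q_0$, $r_{i+1}\in\delta(r_i,\sigma_{i+1})$, accepting iff it traverses $\alpha$-transitions only finitely often; $L(\mathcal{A})$ is the set of accepted words. $\mathcal{A}^q$ is $\mathcal{A}$ with initial state $q$. $\mathcal{A}$ is GFG if there is $f:\Sigma^*\to Q$ with $f(\epsilon)=q_0$, $\langle f(u),\sigma,f(u\sigma)\rangle\in\Delta$ for all $u,\sigma$, and for every $w\in L(\mathcal{A})$ the run $f(w[1,0]),f(w[1,1]),\dots$ is accepting; a state $q$ is GFG if $\mathcal{A}^q$ is. $q\sim s$ iff $L(\mathcal{A}^q)=L(\mathcal{A}^s)$. $\mathcal{A}$ is semantically deterministic if any two $\sigma$-successors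 of any state are $\sim$-equivalent; safe deterministic if $|\delta^{\bar\alpha}(q,\sigma)|\le1$ always; normal if a path of $\bar\alpha$-transitions from $q$ to $s$ implies one from $s$ to $q$. A GFG-tNCW is nice if all states are reachable and GFG and it is normal, safe deterministic and semantically deterministic. Two tNCWs $\mathcal{A},\mathcal{B}$ over $\Sigma$ with state sets $Q_\mathcal{A},Q_\mathcal{B}$ are safe isomorphic if there is a bijection $\kappa:Q_\mathcal{A}\to Q_\mathcal{B}$ such that for all $q,q'\in Q_\mathcal{A}$ and $\sigma\in\Sigma$: $q'\in\delta^{\bar\alpha}_\mathcal{A}(q,\sigma)$ iff $\kappa(q')\in\delta^{\bar\alpha}_\mathcal{B}(\kappa(q),\sigma)$. *)

(* Defs.v *)
From mathcomp Require Import all_boot.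

Set Implicit Arguments.
Unset Strict Implicit.
Unset Printing Implicit Defensive.

Definition trans_rel (Sigma Q : finType) (delta : Q -> Sigma -> {set Q}) :
    {set Q * Sigma * Q} :=
  [set t | t.2 \in delta t.1.1 t.1.2].

Record tNCW (Sigma : finType) := TNCW {
  state :> finType;
  init : state;
  delta : state -> Sigma -> {set state};
  alpha : {set state * Sigma * state};
  delta_total : forall q a, delta q a != set0;
  alpha_sub : alpha \subset trans_rel delta
}.

Arguments init {Sigma} t.
Arguments delta {Sigma} t q a.
Arguments alpha {Sigma} t.

Section Automata.
Variable Sigma : finType.
Implicit Types A B C : tNCW Sigma.

(* The letter sigma_(i+1) of an infinite word is [w i]. *)
Definition word := nat -> Sigma.

Definition Delta A : {set A * Sigma * A} := trans_rel (delta A).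

Definition safe_delta A (q : A) (a : Sigma) : {set A} :=
  [set s | (q, a, s) \in Delta A :\: alpha A].

Definition is_run A (w : word) (r : nat -> A) : Prop :=
  r 0 = init A /\ forall i, r i.+1 \in delta A (r i) (w i).

Definition accepting A (w : word) (r : nat -> A) : Prop :=
  exists n, forall i, n <= i -> (r i, w i, r i.+1) \notin alpha A.

Definition lang A (w : word) : Prop :=
  exists r : nat -> A, is_run w r /\ accepting w r.

Definition lang_eq A B : Prop := forall w, lang A w <-> lang B w.

Definition from A (q : A) : tNCW Sigma :=
  @TNCW Sigma A q (delta A) (alpha A) (@delta_total Sigma A)
    (@alpha_sub Sigma A).

(* [mkseq w i] is the prefix of [w] of length [i]. *)
Definition gfg A : Prop :=
  exists f : seq Sigma -> A,
    [/\ f [::] = init A,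
        forall u a, (f u, a, f (rcons u a)) \in Delta A
      & forall w, lang A w -> accepting w (fun i => f (mkseq w i))].

Definition gfg_state A (q : A) : Prop := gfg (from q).

Definition state_equiv A (q s : A) : Prop := lang_eq (from q) (from s).

Definition step A : rel A := fun q s => [exists a, s \in delta A q a].

Definition safe_step A : rel A := fun q s => [exists a, s \in safe_delta q a].

Definition reachable A (q : A) : Prop := connect (@step A) (init A) q.

Definition semantically_deterministic A : Prop :=
  forall (q : A) a s s',
    s \in delta A q a -> s' \in delta A q a -> state_equiv s s'.

Definition safe_deterministic A : Prop :=
  forall (q : A) a, #|safe_delta q a| <= 1.

Definition normal A : Prop :=
  forall q s : A, connect (@safe_step A) q s -> connect (@safe_step A) s q.

Definition nice A : Prop :=
  [/\ gfg A,
      forall q : A, reachable q /\ gfg_state q,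
      normal A,
      safe_deterministic A
    & semantically_deterministic A].

Definition minimal_gfg A : Prop :=
  forall C, gfg C -> lang_eq C A -> #|A| <= #|C|.

Definition safe_isomorphic A B : Prop :=
  exists kappa : A -> B, bijective kappa /\
    forall (q q' : A) a,
      q' \in safe_delta q a <-> kappa q' \in safe_delta (kappa q) a.

End Automata.

(* Main.v *)
(* Write q <= s when q and s are language equivalent and the safe language of q
   is contained in that of s; this relation is preserved by safe steps. Any
   state of one nice automaton is <= some state of an equivalent one: otherwise
   one builds an accepted word on which the GFG strategy fails infinitely often.
   If a set R of states of A dominates every state, and is closed under safe
   successors up to strong equivalence, then A can be restricted to R. In a
   minimal A this forces strong equivalence to be equality (remove one of two
   strongly equivalent states) and every safe component to be maximal for the
   preorder induced by <= (keep only maximal components). Going from A to B and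
   back along <= then stays in one safe component, so each state of A has a
   strongly equivalent state in B, and this correspondence is the isomorphism. *)
Require Import Defs.
From mathcomp Require Import all_boot.
From mathcomp Require Import boolp.

Set Implicit Arguments.
Unset Strict Implicit.
Unset Printing Implicit Defensive.

(** * Finite labelled paths, used both for all transitions and for safe ones *)

Section LabelledPaths.
Variables (Sigma T : finType) (d : T -> Sigma -> {set T}).

Fixpoint lpath (q : T) (u : seq Sigma) (s : T) : Prop :=
  if u is a :: u' then exists2 t, t \in d q a & lpath t u' s else q = s.

Lemma lpath_cat q u v s :
  lpath q (u ++ v) s <-> exists2 t, lpath q u t & lpath t v s.
Proof.
elim: u q => [|a u IHu] q /=; first by split=> [|[t ->]]; first by exists q.
split=> [[t qt /IHu[p tp ps]]|[p [t qt tp] ps]].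
  by exists p => //; exists t.
by exists t => //; apply/IHu; exists p.
Qed.

Lemma lpath_connect q u s :
  lpath q u s -> connect (fun x y => [exists a, y \in d x a]) q s.
Proof.
elim: u q => [|a u IHu] q /=; first by move=> ->.
case=> t qt /IHu; apply: connect_trans.
by apply: connect1; apply/existsP; exists a.
Qed.

Lemma connect_lpath q s :
  connect (fun x y => [exists a, y \in d x a]) q s -> exists u, lpath q u s.
Proof.
case/connectP=> p; elim: p q => [|t p IHp] q /=; first by move=> _ ->; exists [::].
case/andP=> /existsP[a qt] tp /(IHp _ tp)[u us].
by exists (a :: u); exists t.
Qed.

End LabelledPaths.

(** * Infinite words and their prefixes *)

Section Words.
Variable Sigma : finType.

Definition wcons (a : Sigma) (v : word Sigma) : word Sigma :=
  fun i => if i is j.+1 then v j else a.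

Definition wcat (u : seq Sigma) (v : word Sigma) : word Sigma :=
  foldr wcons v u.

Lemma mkseqD (w : word Sigma) m n :
  mkseq w (m + n) = mkseq w m ++ mkseq (fun i => w (m + i)) n.
Proof.
by rewrite /mkseq iotaD map_cat add0n -{2}[m]addn0 iotaDl -map_comp.
Qed.

Lemma mkseqS (w : word Sigma) n :
  mkseq w n.+1 = w 0 :: mkseq (fun i => w i.+1) n.
Proof. by rewrite -add1n mkseqD. Qed.

Lemma mkseq_rcons (w : word Sigma) n : mkseq w n.+1 = rcons (mkseq w n) (w n).
Proof. by rewrite -addn1 mkseqD -cats1 /mkseq /= addn0. Qed.

Lemma wcat_mkseq (w : word Sigma) n : wcat (mkseq w n) (fun i => w (n + i)) = w.
Proof.
elim: n w => [|n IHn] w; first exact: funext.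
rewrite mkseqS /= (IHn (fun i => w i.+1)).
by apply: funext => -[].
Qed.

End Words.

(** * Residual languages, safe languages and domination between states *)

Section SafeLanguages.
Variable Sigma : finType.
Implicit Types A B : tNCW Sigma.

Lemma safe_deltaE A (q : A) a s :
  (s \in safe_delta q a) = (s \in delta A q a) && ((q, a, s) \notin alpha A).
Proof. by rewrite !inE andbC. Qed.

Lemma safe_delta_inj A (detA : safe_deterministic A) (q : A) a s t :
  s \in safe_delta q a -> t \in safe_delta q a -> s = t.
Proof. by move=> sq tq; have /card_le1_eqP := detA q a; apply. Qed.

Lemma lang_wcons A (q : A) a v :
  lang (from q) (wcons a v) <-> exists2 s, s \in delta A q a & lang (from s) v.
Proof.
split=> [[r [[r0 rS] [n rn]]]|[s qs [r [[r0 rS] [n rn]]]]].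
  exists (r 1); first by have := rS 0; rewrite r0.
  exists (fun i => r i.+1); split; first by split=> // i; exact: (rS i.+1).
  by exists n => i ni; apply: (rn i.+1); rewrite leqW.
exists (fun i => if i is j.+1 then r j else q); split.
  by split=> // -[|i] /=; [rewrite r0 | exact: rS].
by exists n.+1 => -[|i] //; exact: rn.
Qed.

Section Residuals.
Variables (A : tNCW Sigma) (sdA : semantically_deterministic A).

(** Semantic determinism makes all [a]-successors equivalent, so the one chosen by a run can be
    replaced by [s]. *)
Lemma residual1 (q : A) a s v :
  s \in delta A q a -> lang (from q) (wcons a v) <-> lang (from s) v.
Proof.
move=> qs; rewrite lang_wcons; split=> [[t qt]|]; last by exists s.
by move/(sdA qt qs).
Qed.

Lemma residual (q : A) u s v :
  lpath (delta A) q u s -> lang (from q) (wcat u v) <-> lang (from s) v.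
Proof.
elim: u q => [|a u IHu] q /=; first by move=> ->.
by case=> t qt /IHu <-; exact: residual1.
Qed.

End Residuals.

Lemma residual_equiv A B (sdA : semantically_deterministic A)
    (sdB : semantically_deterministic B) (q : A) (s : B) u q' s' :
    lang_eq (from q) (from s) ->
    lpath (delta A) q u q' -> lpath (delta B) s u s' ->
  lang_eq (from q') (from s').
Proof.
by move=> qs qq' ss' w; rewrite -(residual sdA w qq') -(residual sdB w ss').
Qed.

Lemma residual_equiv1 A B (sdA : semantically_deterministic A)
    (sdB : semantically_deterministic B) (q : A) (s : B) a q' s' :
    lang_eq (from q) (from s) -> q' \in delta A q a -> s' \in delta B s a ->
  lang_eq (from q') (from s').
Proof.
move=> qs qq' ss'; apply: (@residual_equiv _ _ sdA sdB q s [:: a]) => //=.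
  by exists q'.
by exists s'.
Qed.

(* Safe languages are taken over finite words: under normality and safe
   determinism, inclusion of these is equivalent to inclusion of the languages
   of infinite safe words. *)
Definition safe_lang A (q : A) (u : seq Sigma) : Prop :=
  exists s, lpath (@safe_delta Sigma A) q u s.

Lemma safe_lang_prefix A (q : A) u v : safe_lang q (u ++ v) -> safe_lang q u.
Proof. by case=> s /lpath_cat[t qt _]; exists t. Qed.

Lemma safe_lpath A (q : A) u s :
  lpath (@safe_delta Sigma A) q u s -> lpath (delta A) q u s.
Proof.
elim: u q => [|a u IHu] q //= [t].
by rewrite safe_deltaE => /andP[qt _] /IHu; exists t.
Qed.

Lemma safe_lang_run A (w : word Sigma) (r : nat -> A) n :
    (forall i, r i.+1 \in safe_delta (r i) (w i)) ->
  safe_lang (r 0) (mkseq w n).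
Proof.
move=> rS; exists (r n).
elim: n w r rS => [//|n IHn] w r rS; rewrite mkseqS /=.
by exists (r 1) => //; apply: (IHn _ (fun i => r i.+1)) => i; exact: rS.
Qed.

(** By safe determinism the safe paths on the prefixes of [w] extend each other, so together they
    form an infinite run without alpha-transitions. *)
Lemma safe_lang_accept A (detA : safe_deterministic A) (q : A) w :
  (forall n, safe_lang q (mkseq w n)) -> lang (from q) w.
Proof.
move=> qw.
(* [nxt] follows the safe successor; where there is none it stays put, a default never met along
   [w]. *)
have /choice[nxt nxtP] : forall x : A * Sigma, exists t : A,
    forall s, s \in safe_delta x.1 x.2 -> t = s.
  case=> p a; have [->|[t pt]] := set_0Vmem (safe_delta p a).
    by exists p => s; rewrite inE.
  by exists t => s; exact: safe_delta_inj.
pose fix r i := if i is j.+1 then nxt (r j, w j) else q.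
have rS i : r i.+1 \in safe_delta (r i) (w i).
  have rP n s : lpath (@safe_delta Sigma A) q (mkseq w n) s -> r n = s.
    elim: n s => [|n IHn] s //; rewrite -addn1 mkseqD => /lpath_cat[t /IHn<-] /=.
    by case=> t'; rewrite addn1 addn0 /= => rt <-; exact: (nxtP (_, _)).
  have [s] := qw i.+1; rewrite -addn1 mkseqD => /lpath_cat[t /rP<-] /=.
  by case=> t'; rewrite addn0 addn1 => rt _; rewrite /= (nxtP (_, _) _ rt).
exists r; split; first by split=> // i; have := rS i; rewrite safe_deltaE => /andP[].
by exists 0 => i _; have := rS i; rewrite safe_deltaE => /andP[].
Qed.

Definition subsafe A B (q : A) (s : B) : Prop :=
  lang_eq (from q) (from s) /\ forall u, safe_lang q u -> safe_lang s u.

Definition strong_equiv A B (q : A) (s : B) : Prop :=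
  subsafe q s /\ subsafe s q.

Lemma subsafe_refl A (q : A) : subsafe q q.
Proof. by split. Qed.

Lemma subsafe_trans A B (C : tNCW Sigma) (q : A) (s : B) (t : C) :
  subsafe q s -> subsafe s t -> subsafe q t.
Proof.
by move=> [qs qsS] [st stS]; split=> [w|u /qsS/stS//]; rewrite qs st.
Qed.

Lemma strong_trans A B (C : tNCW Sigma) (q : A) (s : B) (t : C) :
  strong_equiv q s -> strong_equiv s t -> strong_equiv q t.
Proof. by move=> [qs sq] [st ts]; split; apply: subsafe_trans; eassumption. Qed.

Lemma strong_sym A B (q : A) (s : B) : strong_equiv q s -> strong_equiv s q.
Proof. by case. Qed.

Lemma strategy_lpath A (q0 : A) (f : seq Sigma -> A) u :
    f [::] = q0 -> (forall u a, (f u, a, f (rcons u a)) \in Delta A) ->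
  lpath (delta A) q0 u (f u).
Proof.
move=> f0 fS; elim/last_ind: u => [|u a IHu] //.
rewrite -cats1; apply/lpath_cat; exists (f u) => //=.
by rewrite cats1; exists (f (rcons u a)) => //; have := fS u a; rewrite !inE.
Qed.

(** * Transport of domination along safe transitions *)

Section Transport.
Variables A B : tNCW Sigma.
Hypotheses (sdA : semantically_deterministic A)
  (sdB : semantically_deterministic B) (detB : safe_deterministic B).

(** Safe determinism of [B] sends every safe path of [s] on a word [a :: u] through the same [s'],
    so inclusion passes to the successors. *)
Lemma subsafe_step (q q' : A) (s : B) a :
    subsafe q s -> q' \in safe_delta q a ->
  exists2 s', s' \in safe_delta s a & subsafe q' s'.
Proof.
move=> [qs sub] qq'.
have [|s' [t st _]] := sub [:: a]; first by exists q'; exists q'.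
exists t => //; split=> [|u [p q'p]].
  move: qq' st; rewrite !safe_deltaE => /andP[qq' _] /andP[st _].
  exact: (residual_equiv1 sdA sdB qs qq' st).
have [|p' [t' st' t'p']] := sub (a :: u); first by exists p; exists q'.
by exists p'; rewrite (safe_delta_inj detB st st').
Qed.

Lemma subsafe_connect (q q' : A) (s : B) :
    subsafe q s -> connect (@safe_step _ A) q q' ->
  exists2 s', connect (@safe_step _ B) s s' & subsafe q' s'.
Proof.
move=> qs /connect_lpath[u]; elim: u q s qs => [|a u IHu] q s qs /=.
  by move=> <-; exists s.
case=> t /(subsafe_step qs)[s1 ss1 ts1] /(IHu _ _ ts1)[s' s1s' q's'].
exists s' => //; apply: connect_trans s1s'; apply: connect1.
by apply/existsP; exists a.
Qed.

End Transport.

(** Transporting back along the reverse inclusion can only return to [q'], because [A] is safe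
    deterministic. *)
Lemma strong_step A B (sdA : semantically_deterministic A)
    (sdB : semantically_deterministic B) (detA : safe_deterministic A)
    (detB : safe_deterministic B) (q q' : A) (s : B) a :
    strong_equiv q s -> q' \in safe_delta q a ->
  exists2 s', s' \in safe_delta s a & strong_equiv q' s'.
Proof.
move=> [qs sq] qq'; have [s' ss' q's'] := subsafe_step sdA sdB detB qs qq'.
exists s' => //; split=> //.
have [q1 qq1 s'q1] := subsafe_step sdB sdA detA sq ss'.
by rewrite (safe_delta_inj detA qq' qq1).
Qed.

Lemma strong_connect A B (sdA : semantically_deterministic A)
    (sdB : semantically_deterministic B) (detA : safe_deterministic A)
    (detB : safe_deterministic B) (q q' : A) (s : B) :
    strong_equiv q s -> connect (@safe_step _ A) q q' ->
  exists s' : B, strong_equiv q' s'.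
Proof.
move=> qs /connect_lpath[u]; elim: u q s qs => [|a u IHu] q s qs /=.
  by move=> <-; exists s.
by case=> t /(strong_step sdA sdB detA detB qs)[s1 _ ts1] /(IHu _ _ ts1).
Qed.

(* If no state of B dominates q, each state of B equivalent to q rejects some
   safe cycle of A at q. Chaining these cycles gives a word accepted by A on
   which the strategy of B takes infinitely many alpha-transitions. *)
Lemma subsafe_exists A B (niceA : nice A) (niceB : nice B)
    (eqAB : lang_eq A B) (q : A) : exists s : B, subsafe q s.
Proof.
have [_ reachA normA detA sdA] := niceA.
have [[g [g0 gS gacc]] _ _ detB sdB] := niceB.
apply: contrapT => nsub.
have [u0 u0q] : exists u, lpath (delta A) (init A) u q.
  by apply: connect_lpath; case: (reachA q).
(* States not equivalent to [q] get the dummy cycle [[::]]; they never occur as [g (W k)]. *)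
have /choice[z zP] (s : B) : exists u, lang_eq (from q) (from s) ->
    lpath (@safe_delta _ A) q u q /\ ~ safe_lang s u.
  have [qs|nqs] := pselect (lang_eq (from q) (from s)); last by exists [::].
  have [u [[t qt] nsu]] : exists u, safe_lang q u /\ ~ safe_lang s u.
    apply: contrapT => nu; apply: nsub; exists s; split=> // u qu.
    by apply: contrapT => nsu; apply: nu; exists u.
  have [v tq] := connect_lpath (normA _ _ (lpath_connect qt)).
  exists (u ++ v) => _; split; first by apply/lpath_cat; exists t.
  by move/safe_lang_prefix.
(* Each new cycle is chosen against the state that the strategy has reached by then. *)
pose fix W k := if k is j.+1 then W j ++ z (g (W j)) else u0.
have gP u := strategy_lpath u g0 gS.
have WA k : lpath (delta A) (init A) (W k) q /\ lang_eq (from q) (from (g (W k))).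
  have WP k' : lpath (delta A) (init A) (W k') q ->
      lang_eq (from q) (from (g (W k'))).
    move=> Wq; exact: (residual_equiv sdA sdB (q := init A) (s := init B) eqAB Wq).
  elim: k => [|k [Wq /zP[zq _]]]; first by split; last exact: WP.
  have W'q : lpath (delta A) (init A) (W k.+1) q.
    by apply/lpath_cat; exists q => //; exact: safe_lpath.
  by split; last exact: WP.
have zW k : lpath (@safe_delta _ A) q (z (g (W k))) q /\
    ~ safe_lang (g (W k)) (z (g (W k))) by apply: zP; case: (WA k).
(* The empty word is safe from every state, so each cycle is nonempty and the words [W k] converge
   to an infinite word. *)
have sizeW k : k <= size (W k).
  elim: k => //= k IHk; rewrite size_cat -addn1 leq_add //.
  case: (zW k) => _; case: (z _) => // -[]; by exists (g (W k)).
have [a0 _] : exists a : Sigma, True.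
  by have := sizeW 1; case: (W 1) => // a; exists a.
have prefW k m : prefix (W k) (W (k + m)).
  elim: m => [|m IHm]; first by rewrite addn0 prefix_refl.
  by rewrite addnS /=; apply: prefix_trans IHm _; exact: prefix_prefix.
pose w i := nth a0 (W i.+1) i.
have nthW k i : i < size (W k) -> nth a0 (W k) i = w i.
  move=> ik; rewrite /w; have [le|/ltnW le] := leqP k i.+1.
    by have /prefixP[v] := prefW k (i.+1 - k); rewrite subnKC // => ->;
      rewrite nth_cat ik.
  have /prefixP[v] := prefW i.+1 (k - i.+1); rewrite subnKC // => ->.
  by rewrite nth_cat sizeW.
have wW k : mkseq w (size (W k)) = W k.
  apply: (@eq_from_nth _ a0); rewrite size_mkseq // => i ik.
  by rewrite nth_mkseq // nthW.
have wA : lang A w.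
  rewrite -(wcat_mkseq w (size u0)) (wW 0).
  apply/(residual sdA (q := init A) _ u0q).
  apply: (safe_lang_accept detA) => n.
  have safeW k : exists2 v, W k = u0 ++ v & lpath (@safe_delta _ A) q v q.
    elim: k => [|k [v Wk vq]] /=; first by exists [::]; rewrite ?cats0.
    exists (v ++ z (g (W k))); first by rewrite catA -Wk.
    by apply/lpath_cat; exists q => //; case: (zW k).
  have [v Wv vq] := safeW (size u0 + n).
  have /subnKC lev : n <= size v.
    by rewrite -(leq_add2l (size u0)) -size_cat -Wv sizeW.
  apply: (@safe_lang_prefix _ _ (mkseq (fun i => w (size u0 + i)) n)
    (mkseq (fun i => w (size u0 + (n + i))) (size v - n))).
  rewrite -(mkseqD (fun i => w (size u0 + i))) lev.
  suff -> : mkseq (fun i => w (size u0 + i)) (size v) = v by exists q.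
  have := wW (size u0 + n); rewrite Wv size_cat mkseqD (wW 0) => /eqP.
  by rewrite eqseq_cat // => /andP[_ /eqP].
have [n accn] := gacc w ((eqAB w).1 wA).
(* From position [n] on the strategy is safe, and [size (W n)] is at least [n], so it would read the
   next cycle safely. *)
have [_] := zW n; apply.
set m := size (W n); set l := size (z (g (W n))).
have -> : z (g (W n)) = mkseq (fun i => w (m + i)) l.
  have := wW n.+1; rewrite /= size_cat mkseqD wW => /eqP.
  by rewrite eqseq_cat // => /andP[_ /eqP].
have -> : g (W n) = g (mkseq w (m + 0)) by rewrite addn0 wW.
apply: (@safe_lang_run B (fun i => w (m + i)) (fun i => g (mkseq w (m + i)))).
move=> i; rewrite safe_deltaE addnS; apply/andP; split; last first.
  by apply: accn; rewrite (leq_trans (sizeW n)) ?leq_addr.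
have := gS (mkseq w (m + i)) (w (m + i)); rewrite !inE /=.
by rewrite mkseq_rcons.
Qed.

(** * Restriction of an automaton to a dominating set of states *)

Section Restriction.
Variables (A : tNCW Sigma) (R : {set A}).
Hypotheses (sdA : semantically_deterministic A) (detA : safe_deterministic A)
  (coverR : forall q : A, exists2 r, r \in R & subsafe q r)
  (closedR : forall (r q : A) a, r \in R -> q \in safe_delta r a ->
     exists2 p, p \in R & strong_equiv q p).

Let S : finType := {q : A | q \in R}.

(** A transition may end in any state of [R] equivalent to a successor, so that a strategy can jump
    to a dominating state. *)
Definition restr_delta (r : S) a : {set S} :=
  [set p : S | [exists t in delta A (val r) a, `[< state_equiv t (val p) >]]].

(** Strong equivalence is demanded here so that safe runs lift to safe runs of [A]. *)
Definition restr_safe (r : S) a : {set S} :=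
  [set p : S | [exists t in safe_delta (val r) a, `[< strong_equiv t (val p) >]]].

Definition restr_alpha : {set S * Sigma * S} :=
  [set x in trans_rel restr_delta | x.2 \notin restr_safe x.1.1 x.1.2].

Lemma restr_deltaP (r p : S) a :
  reflect (exists2 t, t \in delta A (val r) a & state_equiv t (val p))
    (p \in restr_delta r a).
Proof.
rewrite inE; apply: (iffP existsP) => [[t /andP[? /asboolP]]|[t ? ?]].
  by exists t.
by exists t; apply/andP; split; last exact/asboolP.
Qed.

Lemma restr_safeP (r p : S) a :
  reflect (exists2 t, t \in safe_delta (val r) a & strong_equiv t (val p))
    (p \in restr_safe r a).
Proof.
rewrite inE; apply: (iffP existsP) => [[t /andP[? /asboolP]]|[t ? ?]].
  by exists t.
by exists t; apply/andP; split; last exact/asboolP.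
Qed.

Lemma cover_val (q : A) : exists r : S, subsafe q (val r).
Proof. by have [r rR qr] := coverR q; exists (exist _ r rR). Qed.

Lemma restr_total r a : restr_delta r a != set0.
Proof.
have /set0Pn[t rt] := delta_total (val r) a.
have [p [tp _]] := cover_val t.
by apply/set0Pn; exists p; apply/restr_deltaP; exists t.
Qed.

Lemma restr_alpha_sub : restr_alpha \subset trans_rel restr_delta.
Proof. by apply/subsetP => x; rewrite inE => /andP[]. Qed.

Definition restr (r0 : S) : tNCW Sigma :=
  TNCW r0 restr_total restr_alpha_sub.

Lemma restr_alphaE (r p : S) a :
  p \in restr_delta r a -> (r, a, p) \notin restr_alpha = (p \in restr_safe r a).
Proof.
move=> rp; have rp' : (r, a, p) \in trans_rel restr_delta by rewrite in_set.
by rewrite /restr_alpha in_set rp' negbK.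
Qed.

(** Up to [n] a path of [A] follows the restricted run up to language equivalence; from [n] on,
    strong equivalence turns the safe run into safe paths of [A] from [val (r n)]. *)
Lemma restr_lang (r0 : S) w :
  subsafe (init A) (val r0) -> lang (restr r0) w -> lang A w.
Proof.
move=> [Ar0 _] [r [[/= rr0 rS] [n accn]]].
have rP i : exists2 q, lpath (delta A) (init A) (mkseq w i) q &
    lang_eq (from q) (from (val (r i))).
  elim: i => [|i [q qi qr]]; first by exists (init A); rewrite ?rr0.
  have /restr_deltaP[t rt tr] := rS i.
  have /set0Pn[q' qq'] := delta_total q (w i); exists q'.
    rewrite -addn1 mkseqD; apply/lpath_cat; exists q => //=.
    by exists q'; rewrite ?addn0.
  by move=> v; rewrite (residual_equiv1 sdA sdA qr qq' rt v); exact: tr.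
have [q qn qr] := rP n.
rewrite -(wcat_mkseq w n); apply/(residual sdA (q := init A) _ qn)/qr.
apply: (safe_lang_accept detA) => m.
suff [s [rs _]] : exists s, lpath (@safe_delta _ A) (val (r n))
    (mkseq (fun i => w (n + i)) m) s /\ strong_equiv s (val (r (n + m))).
  by exists s.
elim: m => [|m [s [rs sr]]].
  by exists (val (r n)); rewrite addn0; split=> //; split; exact: subsafe_refl.
have /restr_safeP[t rt tr] : r (n + m).+1 \in restr_safe (r (n + m)) (w (n + m)).
  by rewrite -restr_alphaE; [apply: accn; rewrite leq_addr | exact: rS].
have [t' st' tt'] := strong_step sdA sdA detA detA (strong_sym sr) rt.
exists t'; split; last by rewrite addnS; exact: strong_trans (strong_sym tt') tr.
rewrite -addn1 mkseqD; apply/lpath_cat; exists s => //=.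
by exists t' => //; rewrite addn0.
Qed.

(* The strategy of the restriction takes an alpha-transition only when forced
   to, and then jumps to a state dominating the current state of f. Once f is
   safe this happens at most once. *)
Lemma restr_gfg (r0 : S) :
    subsafe (init A) (val r0) -> gfg A ->
  gfg (restr r0) /\ (forall w, lang A w -> lang (restr r0) w).
Proof.
move=> Ar0 [f [f0 fS facc]].
have /choice[rep repP] := cover_val.
pose nxt (r : S) a q := if [pick p in restr_safe r a] is Some p then p else rep q.
(* [h] recurses on reversed words because histories grow at the end. *)
pose fix h u := if u is a :: u' then nxt (h u') a (f (rev u)) else r0.
pose g u := h (rev u).
have gE u a : g (rcons u a) = nxt (g u) a (f (rcons u a)).
  by rewrite /g rev_rcons /= -rev_rcons revK.
have fD u a : f (rcons u a) \in delta A (f u) a by have := fS u a; rewrite !inE.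
have fg u : lang_eq (from (f u)) (from (val (g u))).
  elim/last_ind: u => [|u a IHu]; first by rewrite f0; case: Ar0.
  rewrite gE /nxt; case: pickP => [p /restr_safeP[t gt [[tp _] _]]|_].
    move: gt; rewrite safe_deltaE => /andP[gt _] v.
    by rewrite (residual_equiv1 sdA sdA IHu (fD u a) gt v).
  by case: (repP (f (rcons u a))).
have gD u a : g (rcons u a) \in restr_delta (g u) a.
  have /set0Pn[t gt] := delta_total (val (g u)) a.
  apply/restr_deltaP; exists t => // v.
  by rewrite -(residual_equiv1 sdA sdA (fg u) (fD u a) gt v); exact: fg.
have gsub u a : f (rcons u a) \in safe_delta (f u) a ->
    subsafe (f u) (val (g u)) -> g (rcons u a) \in restr_safe (g u) a /\
      subsafe (f (rcons u a)) (val (g (rcons u a))).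
  move=> fsafe fgu; have [s gs fs] := subsafe_step sdA sdA detA fgu fsafe.
  (* [closedR] guarantees a safe choice for [pick]; by safe determinism any choice is strongly
     equivalent to [s]. *)
  have [p pR sp] := closedR (valP (g u)) gs.
  rewrite gE /nxt; case: pickP => [p' gp'|/(_ (exist _ p pR)) /restr_safeP[]].
    split=> //; have /restr_safeP[t gt [tp' _]] := gp'.
    by rewrite (safe_delta_inj detA gs gt) in fs; exact: subsafe_trans tp'.
  by exists s.
have gacc w : lang A w -> exists n, forall i, n <= i ->
    g (mkseq w i.+1) \in restr_safe (g (mkseq w i)) (w i).
  move=> /facc[n accn].
  have fsafe i : n <= i ->
      f (rcons (mkseq w i) (w i)) \in safe_delta (f (mkseq w i)) (w i).
    by move=> ni; rewrite safe_deltaE fD -mkseq_rcons accn.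
  have stay m : n <= m -> subsafe (f (mkseq w m)) (val (g (mkseq w m))) ->
      forall i, m <= i -> g (mkseq w i.+1) \in restr_safe (g (mkseq w i)) (w i).
    move=> nm fgm i mi.
    suff fgi : subsafe (f (mkseq w i)) (val (g (mkseq w i))).
      by rewrite mkseq_rcons; case: (gsub _ _ (fsafe i (leq_trans nm mi)) fgi).
    rewrite -(subnKC mi); elim: (i - m) => [|k IHk]; first by rewrite addn0.
    rewrite addnS mkseq_rcons; have nk : n <= m + k by rewrite (leq_trans nm) ?leq_addr.
    by case: (gsub _ _ (fsafe _ nk) IHk).
  have [//|jump] := pselect (forall i, n <= i ->
    g (mkseq w i.+1) \in restr_safe (g (mkseq w i)) (w i)); first by exists n.
  have [m nm gm] : exists2 m, n <= m &
      g (mkseq w m.+1) \notin restr_safe (g (mkseq w m)) (w m).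
    apply: contrapT => nojump; apply: jump => i ni.
    by apply: contrapT => /negP gi; apply: nojump; exists i.
  (* Just after the alpha-transition at [m], [rep] makes the new state dominate that of [f]. *)
  exists m.+1; apply: stay; first exact: leqW.
  move: gm; rewrite mkseq_rcons gE /nxt.
  by case: pickP => [p -> //|_ _]; exact: repP.
have acc w : lang A w -> @accepting _ (restr r0) w (fun i => g (mkseq w i)).
  move=> /gacc[n accn]; exists n => i ni; rewrite [_ \notin _]restr_alphaE ?accn //.
  by rewrite mkseq_rcons.
split=> [|w wA].
  exists g; split=> // [u a|w /(restr_lang Ar0)/acc //].
  by have := gD u a; rewrite /Delta !inE.
exists (fun i => g (mkseq w i)); split; last exact: acc.
by split=> // i; rewrite mkseq_rcons.
Qed.

(** The restriction is a GFG automaton for the same language with as many states as [R]. *)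
Lemma minimal_cover : gfg A -> minimal_gfg A -> R = setT.
Proof.
move=> gfgA minA; have [r0 Ar0] := cover_val (init A).
have [gfgC AC] := restr_gfg Ar0 gfgA.
have le : #|A| <= #|S|.
  by apply: (minA (restr r0) gfgC) => w; split=> [/(restr_lang Ar0)|/AC].
by apply/eqP; rewrite eqEcard subsetT cardsT (leq_trans le) // card_sig.
Qed.

End Restriction.

(** Otherwise the complement of [q] would be a dominating set, with [s] standing in for [q]. *)
Lemma minimal_strong_eq A (niceA : nice A) (minA : minimal_gfg A) (q s : A) :
  strong_equiv q s -> q = s.
Proof.
have [gfgA _ _ detA sdA] := niceA.
move=> qs; apply: contrapT => /eqP neq.
suff : [set~ q] = setT by move/setP/(_ q); rewrite !inE eqxx.
have rep (t : A) : exists2 p, p \in [set~ q] & strong_equiv t p.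
  have [->|tq] := eqVneq t q; first by exists s; rewrite ?inE // eq_sym.
  by exists t; rewrite ?inE //; split; exact: subsafe_refl.
apply: minimal_cover => // t.
by have [p pR [tp _]] := rep t; exists p.
Qed.

(* The safe component of q is dominated by that of s. *)
Definition below A (q s : A) : Prop :=
  exists2 s', connect (@safe_step _ A) s s' & subsafe q s'.

Definition safe_maximal A (q : A) : Prop := forall t, below q t -> below t q.

(** * Maximal safe components *)

Section Maximality.
Variables (A : tNCW Sigma) (niceA : nice A).

Lemma connect_below (q s : A) : connect (@safe_step _ A) s q -> below q s.
Proof. by exists q => //; exact: subsafe_refl. Qed.

(** The domination of [s] by [t'] is carried along the safe path from [s] to [s']. *)
Lemma below_trans (q s t : A) : below q s -> below s t -> below q t.
Proof.
have [_ _ _ detA sdA] := niceA.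
move=> [s' ss' qs'] [t' tt' st'].
have [t1 t't1 s't1] := subsafe_connect sdA sdA detA st' ss'.
by exists t1; [exact: connect_trans t't1 | exact: subsafe_trans s't1].
Qed.

Lemma safe_maximal_connect (q s : A) :
  connect (@safe_step _ A) q s -> safe_maximal q -> safe_maximal s.
Proof.
have [_ _ normA _ _] := niceA.
move=> qs maxq t st; apply: (@below_trans _ q); last exact/connect_below/normA.
by apply: maxq; apply: below_trans st; exact/connect_below/normA.
Qed.

Lemma safe_maximal_exists (q : A) : exists2 r : A, safe_maximal r & subsafe q r.
Proof.
have qq : `[< below q q >] by apply/asboolP/connect_below; exact: connect0.
pose up s := [set t : A | `[< below s t >]].
have upP s t : reflect (below s t) (t \in up s) by rewrite inE; exact: asboolP.
(* A state above [q] with the fewest states above it is maximal. *)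
case: (@arg_minnP _ q (fun s => `[< below q s >]) (fun s => #|up s|) qq) => s /asboolP qs mins.
have [s' ss' qs'] := qs; exists s' => //.
apply: safe_maximal_connect ss' _ => t st.
have upts : up t \subset up s.
  by apply/subsetP => x /upP tx; apply/upP; exact: below_trans tx.
have /eqP upE : up t == up s.
  by rewrite eqEcard upts mins //; apply/asboolP; exact: below_trans st.
by apply/upP; rewrite upE; apply/upP/connect_below; exact: connect0.
Qed.

(** The safe-maximal states dominate all states and are closed under safe steps, so minimality
    leaves no others. *)
Lemma minimal_safe_maximal (minA : minimal_gfg A) (q : A) : safe_maximal q.
Proof.
have [gfgA _ _ detA sdA] := niceA.
pose R := [set q : A | `[< safe_maximal q >]].
have RP r : reflect (safe_maximal r) (r \in R) by rewrite inE; exact: asboolP.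
suff RT : R = setT by apply/RP; rewrite RT inE.
apply: minimal_cover => // [t|r t a /RP maxr rt].
  by have [r /RP rR tr] := safe_maximal_exists t; exists r.
exists t; last by split; exact: subsafe_refl.
apply/RP; apply: safe_maximal_connect maxr; apply: connect1.
by apply/existsP; exists a.
Qed.

End Maximality.

Lemma strong_exists A B (niceA : nice A) (niceB : nice B) (eqAB : lang_eq A B)
  (minA : minimal_gfg A) (q : A) : exists s : B, strong_equiv q s.
Proof.
have [_ _ normA detA sdA] := niceA; have [_ _ _ detB sdB] := niceB.
pose up (p : A) := [set t : A | `[< subsafe p t >]].
have upP (p t : A) : reflect (subsafe p t) (t \in up p) by rewrite inE; exact: asboolP.
have upS (p t : A) : subsafe p t -> up t \subset up p.
  by move=> pt; apply/subsetP => x /upP tx; apply/upP; exact: subsafe_trans tx.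
(* [q0] has the fewest dominating states within the safe component of [q], so its domination by a
   state of that component is mutual. *)
have [q0 qq0 minq0] := @arg_minnP _ q (connect (@safe_step _ A) q) (fun p => #|up p|) (connect0 _ q).
have [s q0s] := subsafe_exists niceA niceB eqAB q0.
have [|q1 sq1] := subsafe_exists niceB niceA _ s.
  by move=> w; rewrite eqAB.
(* Maximality of [q0] brings the round trip through [B] back to a state [q2] of the safe component
   of [q0]. *)
have [q2 q02 q12] : below q1 q0.
  apply: (minimal_safe_maximal niceA minA); exists q1; first exact: connect0.
  exact: subsafe_trans sq1.
have sq2 := subsafe_trans sq1 q12.
have /eqP upE : up q2 == up q0.
  by rewrite eqEcard (upS _ _ (subsafe_trans q0s sq2)) minq0 // (connect_trans qq0).
have q20 : subsafe q2 q0 by apply/upP; rewrite upE; apply/upP; exact: subsafe_refl.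
(* Normality gives a safe path from [q0] back to [q], along which strong equivalence is carried. *)
apply: (strong_connect sdA sdB detA detB (q := q0) (s := s)).
  by split=> //; exact: subsafe_trans sq2 q20.
exact: normA.
Qed.

End SafeLanguages.

(** * Construction of the isomorphism *)

Theorem theorem4p2 (Sigma : finType) (A B : tNCW Sigma)
    (niceA : nice A) (niceB : nice B)
    (eqAB : lang_eq A B)
    (minA : minimal_gfg A) (minB : minimal_gfg B) :
  safe_isomorphic A B.
Proof.
have [_ _ _ detA sdA] := niceA; have [_ _ _ detB sdB] := niceB.
have eqBA : lang_eq B A by move=> w; rewrite eqAB.
have /choice[kappa kappaP] := strong_exists niceA niceB eqAB minA.
have /choice[kappa' kappa'P] := strong_exists niceB niceA eqBA minB.
(* Minimality of [B] makes the strongly equivalent partner unique. *)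
have kappaU q s : strong_equiv q s -> kappa q = s.
  by move=> qs; apply: (minimal_strong_eq niceB minB);
    apply: strong_trans qs; exact: strong_sym.
exists kappa; split.
  exists kappa' => [q|s]; last by apply/kappaU/strong_sym.
  by apply: (minimal_strong_eq niceA minA); apply/strong_sym;
    apply: strong_trans (kappaP q) _; exact: kappa'P.
move=> q q' a; split=> [qq'|kk'].
  by have [s ks /kappaU->] := strong_step sdA sdB detA detB (kappaP q) qq'.
(* [q1] and [q'] are both strongly equivalent to [kappa q'], hence equal by minimality of [A]. *)
have [q1 qq1 kq1] := strong_step sdB sdA detB detA (strong_sym (kappaP q)) kk'.
by rewrite (minimal_strong_eq niceA minA (strong_trans (kappaP q') kq1)).
Qed.
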